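(* Let $\mathcal{H}$ be a separable complex Hilbert space. If $T \in \mathcal{B}(\mathcal{H})$ is a product of two projections, then $$\mathcal{H}_{cnu} = \ker T \bigvee \ker T^*,$$ where $\mathcal{H}_{cnu}$ is the completely non-unitary part of the contraction $T$.
   Context: A projection is an orthogonal projection: $P \in \mathcal{B}(\mathcal{H})$ with $P = P^* = P^2$. The symbol $\bigvee$ denotes the closed linear span of the subspaces. For a contraction $T \in \mathcal{B}(\mathcal{H})$, the canonical (Nagy-Foias and Langer) decomposition is the unique orthogonal decomposition $\mathcal{H} = \mathcal{H}_u \oplus \mathcal{H}_{cnu}$ such that both $\mathcal{H}_u$ and $\mathcal{H}_{cnu}$ reduce $T$, $T|_{\mathcal{H}_u}$ is unitary, and $T|_{\mathcal{H}_{cnu}}$ is completely non-unitary (it has no nontrivial unitary summand). Here $\mathcal{H}_u = \{h \in \mathcal{H}: \|T^m h\| = \|T^{*m} h\| = \|h\| \text{ for all } m \in \mathbb{N}\}$ and $\mathcal{H}_{cnu} = \mathcal{H}_u^\perp$. *)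

(* Defs.v *)
From HB Require Import structures.
From mathcomp Require Import all_boot all_order all_algebra.
From mathcomp Require Import complex sesquilinear.
From mathcomp Require Import all_classical all_reals all_analysis.

Set Implicit Arguments.
Unset Strict Implicit.
Unset Printing Implicit Defensive.

Import Order.TTheory GRing.Theory Num.Theory.
Import numFieldNormedType.Exports.

Local Open Scope classical_set_scope.
Local Open Scope ring_scope.

Definition separable (X : topologicalType) : Prop :=
  exists2 D : set X, countable D & dense D.

Section HilbertSpace.
Context (R : realType) (H : completeNormedModType R[i]).
Context (ip : {dot H for Num.conj}).

(* The inner product is linear in its first argument. A complex Hilbert space
   is a complete normed space whose norm comes from such an inner product. *)
Definition induces_norm : Prop := forall x : H, ip x x = `|x| ^+ 2.

Definition is_adjoint (T S : H -> H) : Prop :=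
  forall x y, ip (T x) y = ip x (S y).

(* By the Riesz representation theorem this choice is never the default value
   when T is linear and continuous; the adjoint is unique by [adjointE]. *)
Definition adjoint (T : H -> H) : H -> H := get (is_adjoint T).

Lemma adjointE (T S : H -> H) : is_adjoint T S -> adjoint T = S.
Proof.
move=> TS; have TA : is_adjoint T (adjoint T) by exact: (getI TS).
apply/funext => y; apply/eqP; rewrite -subr_eq0; apply/negPn/negP => d0.
have : 0 < ip (adjoint T y - S y) (adjoint T y - S y).
  exact: neq0_dnorm_gt0.
by rewrite linearB /= -TA -TS subrr ltxx.
Qed.

Definition projection (P : {linear H -> H}) : Prop :=
  [/\ continuous P, is_adjoint P P & P \o P = P].

Definition ker (T : H -> H) : set H := [set x | T x = 0].

Definition orthogonal_complement (A : set H) : set H :=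
  [set x | forall a, A a -> ip x a = 0].

Definition linear_span (A : set H) : set H :=
  [set x | exists n (c : 'I_n -> R[i]) (v : 'I_n -> H),
     (forall i, A (v i)) /\ x = \sum_(i < n) c i *: v i].

Definition closed_span_join (A B : set H) : set H :=
  closure (linear_span (A `|` B)).

Definition unitary_part (T : H -> H) : set H :=
  [set h | forall m : nat,
     `|iter m T h| = `|h| /\ `|iter m (adjoint T) h| = `|h|].

Definition cnu_part (T : H -> H) : set H :=
  orthogonal_complement (unitary_part T).

End HilbertSpace.

(* Main.v *)
Require Import Defs.
From mathcomp Require Import all_boot all_order all_algebra.
From mathcomp Require Import complex sesquilinear.
From mathcomp Require Import all_classical all_reals all_analysis.
From mathcomp Require Import ring lra.

Import Order.TTheory GRing.Theory Num.Theory.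
Import numFieldNormedType.Exports.
Local Open Scope classical_set_scope.
Local Open Scope ring_scope.

(** Write [T = P Q] with [P] and [Q] projections, and let [M] be the set of
    common fixed points of [P] and [Q], that is [ran P] intersected with
    [ran Q]. The two sides of the theorem are both the orthogonal complement
    of [M].

    The unitary part of [T] is [M]: a projection strictly shortens every
    vector that it moves, so already [|P Q h| = |h|] forces [Q h = h] and then
    [P h = h] ([unitary_part_projection_comp]). The kernels of [T] and of
    [T^* = Q P] are orthogonal to [M], because both operators fix [M]
    pointwise; as orthogonal complements are closed subspaces, the closed span
    of the two kernels is orthogonal to [M] too.

    For the converse it is enough that every [x] orthogonal to [M] lies in the
    closed span of [ker P] and [ker Q], since [ker Q] is inside [ker (P Q)] and
    [ker P] inside [ker (Q P)]. This is von Neumann's theorem on alternating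
    projections ([alternating_projections_cvg]): the iterates
    [(T T^* )^n x] converge to some [y] in [M]. Each application of a
    projection changes its argument by an element of that projection's kernel,
    so [x - y] is in the closed span of the kernels
    ([orthogonal_fixed_points_sub]). Hence [x - y], and with it [y], is
    orthogonal to [M]; being also in [M], [y] vanishes.

    The convergence has nothing to do with projections: for contractions [T]
    and [S] adjoint to each other, the inner product of
    [(T S)^m x] and [(T S)^n x] depends on [m + n] only, and as a function
    of [m + n] it is nonnegative and nonincreasing. A sequence with such a Gram
    matrix is Cauchy ([Hankel_Gram_cvg]). *)

(** * Inner products and orthogonal complements *)

Section InnerProduct.
Context {R : realType} {H : completeNormedModType R[i]}.
Context {ip : {dot H for Num.conj}}.
Hypothesis ip_norm : induces_norm ip.

Lemma ip_conj x y : ip x y = (ip y x)^*.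
Proof. by rewrite (hermC ip) /= expr0 mul1r. Qed.

Lemma normBsq x y :
  `|x - y| ^+ 2 = `|x| ^+ 2 + `|y| ^+ 2 - (ip x y + ip y x).
Proof. by rewrite -!ip_norm (dnormB ip) -ip_conj. Qed.

Lemma Cauchy_Schwarz x y : `|ip x y| <= `|x| * `|y|.
Proof.
have [->|y0] := eqVneq y 0; first by rewrite linear0r !normr0 mulr0.
have ny0 : 0 < `|y| ^+ 2 by rewrite exprn_gt0 // normr_gt0.
(* [a *: y] is the orthogonal projection of x onto the line through y, which
   makes the squared norm of the difference as informative as possible. *)
pose a := ip x y / `|y| ^+ 2.
have: 0 <= `|x - a *: y| ^+ 2 by rewrite exprn_ge0.
have ayx : ip (a *: y) x = a * ip y x by rewrite linearZl_LR.
have aE : ip x y = a * `|y| ^+ 2 by rewrite divfK ?gt_eqF.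
have conjM (u v : R[i]) : (u * v)^* = u^* * v^* by rewrite rmorphM.
have axy : ip x (a *: y) = a^* * ip x y by rewrite ip_conj ayx conjM -ip_conj.
have yxE : ip y x = a^* * `|y| ^+ 2.
  by rewrite ip_conj aE conjM -ip_norm -ip_conj.
rewrite normBsq ayx axy yxE aE normrZ exprMn.
rewrite normrM (ger0_norm (ltW ny0)) (normCK a) => h.
rewrite -(ler_pXn2r (n := 2)) ?nnegrE ?mulr_ge0 ?exprn_ge0 //.
rewrite exprMn normCK -subr_ge0.
(* The inequality is [h] multiplied by the squared norm of y. *)
have := mulr_ge0 (ltW ny0) h; congr (0 <= _); ring.
Qed.

Lemma closed_orthogonal_complement (A : set H) :
  closed (orthogonal_complement ip A).
Proof.
(* If [ip x a] were nonzero, Cauchy-Schwarz would keep x away from every vector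
   orthogonal to a; adding 1 to the norm of a allows for [a = 0]. *)
move=> x xA a Aa; apply/eqP/negPn/negP => xa0.
have na : 0 < `|a| + 1 by rewrite ltr_wpDl.
have e0 : 0 < `|ip x a| / (`|a| + 1) by rewrite divr_gt0 // normr_gt0.
have [y [/(_ a Aa) ya]] := xA _ (nbhsx_ballx x _ e0).
rewrite -ball_normE /= ltr_pdivlMr // => xy.
suff : `|ip x a| <= `|x - y| * (`|a| + 1).
  by move=> /le_lt_trans /(_ xy); rewrite ltxx.
rewrite (_ : ip x a = ip (x - y) a); last by rewrite linearBl /= ya subr0.
by rewrite (le_trans (Cauchy_Schwarz _ _)) // ler_wpM2l // lerDl.
Qed.

Lemma linear_span_orthogonal (A B : set H) :
  A `<=` orthogonal_complement ip B ->
  linear_span A `<=` orthogonal_complement ip B.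
Proof.
move=> AB _ [n [c [v [Av ->]]]] b Bb.
rewrite linear_sumlz big1 //= => i _.
by rewrite linearZl_LR /= AB // mulr0.
Qed.

Lemma closed_span_join_orthogonal (A B M : set H) :
  A `<=` orthogonal_complement ip M -> B `<=` orthogonal_complement ip M ->
  closed_span_join A B `<=` orthogonal_complement ip M.
Proof.
move=> AM BM.
rewrite [X in _ `<=` X](closure_id _).1; last first.
  exact: closed_orthogonal_complement.
apply: closure_subset; apply: linear_span_orthogonal.
by move=> x [/AM|/BM].
Qed.

Lemma sub_linear_span (A : set H) : A `<=` linear_span A.
Proof.
move=> x Ax; exists 1, (fun=> 1), (fun=> x); split => //.
by rewrite big_ord1 scale1r.
Qed.

Lemma linear_spanD (A : set H) x y :
  linear_span A x -> linear_span A y -> linear_span A (x + y).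
Proof.
move=> [m [c [v [Av ->]]]] [n [d [w [Aw ->]]]].
pose glue (T : Type) (f : 'I_m -> T) (g : 'I_n -> T) (i : 'I_(m + n)) :=
  match fintype.split i with inl j => f j | inr k => g k end.
exists (m + n)%N, (glue _ c d), (glue _ v w); split.
  by move=> i; rewrite /glue; case: fintype.split.
rewrite big_split_ord /=; congr (_ + _); apply: eq_bigr => i _; rewrite /glue.
  by rewrite (unsplitK (inl i)).
by rewrite (unsplitK (inr i)).
Qed.

(** * Strong convergence of the powers of T T^* *)

(** The squared distance from [u N] to [u n] is
    [(a (N + N) - a (N + n)) + (a (n + n) - a (N + n))], and [a], being
    monotone and bounded below, is a Cauchy sequence. *)
Lemma Hankel_Gram_cvg (u : nat -> H) (a : nat -> R[i]) :
  (forall m n, ip (u m) (u n) = a (m + n)%N) ->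
  (forall k, 0 <= a k.+1 <= a k) -> cvgn u.
Proof.
move=> ua a_mono.
have a_ge0 k : 0 <= a k.
  by have /andP[ak1 /(le_trans ak1)] := a_mono k.
(* Monotone convergence is a fact about the reals, hence the real sequence b
   with the same values as a. *)
pose b k := complex.Re (a k).
have aE k : a k = (b k)%:C%C by rewrite RRe_real // ger0_real.
have b_ge0 k : 0 <= b k by rewrite -ler0c -aE.
have b_anti : nonincreasing_seq b.
  by apply/nonincreasing_seqP => k; rewrite -lecR -!aE; case/andP: (a_mono k).
have b_cvg : cvgn b.
  by apply: nonincreasing_is_cvgn => //; exists 0 => _ [k _ <-].
apply/cauchy_cvgP/cauchy_exP => e e0.
have /complex_realP[d de] : e \is Num.real by rewrite gtr0_real.
have d0 : 0 < d by rewrite -ltcR -de.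
have [N _ bN] : \forall n \near \oo, `|limn b - b n| < d ^+ 2 / 2.
  by move/cvgrPdist_lt : b_cvg; apply; rewrite divr_gt0 // exprn_gt0.
exists (u N); exists N => // n /= Nn.
(* Both differences that make up the squared distance are at most
   [b N - lim b < d ^ 2 / 2]. *)
rewrite -ball_normE /= -(ltr_pXn2r (n := 2)) ?nnegrE ?(ltW e0) //.
rewrite normBsq -!ip_norm !ua (addnC n N) !aE de.
have lb k : limn b <= b k by exact: nonincreasing_cvgn_ge.
have := bN N (leqnn N); rewrite ler0_norm ?subr_le0 // => bN_lim.
have bNN : b (N + N)%N <= b N by apply: b_anti; exact: leq_addr.
have bnn : b (n + n)%N <= b N.
  by apply: b_anti; rewrite (leq_trans Nn) ?leq_addr.
have bNn := lb (N + n)%N.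
rewrite -!rmorphD -rmorphB -rmorphXn /= ltcR.
lra.
Qed.

(** With [A = T S] and [a k] the inner product of [A^k x] and [x], the even
    terms are [a (2n) = |A^n x|^2] and the odd ones
    [a (2n + 1) = |S A^n x|^2]. Passing from one term to the next applies
    alternately [S] and [T] inside the norm, so [a] is nonincreasing. *)
Lemma iter_adjoint_comp_cvg (T S : H -> H) x :
  is_adjoint ip T S ->
  (forall y, `|T y| <= `|y|) -> (forall y, `|S y| <= `|y|) ->
  cvgn (fun n => iter n (T \o S) x).
Proof.
move=> TS Tle Sle; set A := T \o S.
have ST y z : ip (S y) z = ip y (T z) by rewrite ip_conj -TS -ip_conj.
have AA y z : ip (A y) z = ip y (A z) by rewrite /A /= TS ST.
have gram m n : ip (iter m A x) (iter n A x) = ip (iter (m + n) A x) x.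
  by elim: n m => [|n IH] m; rewrite ?addn0 //= -AA -iterS IH addSnnS.
apply: (Hankel_Gram_cvg _ (fun k => ip (iter k A x) x)) => // k.
have sq y z : `|y| <= `|z| -> ip y y <= ip z z.
  by rewrite !ip_norm => yz; rewrite ler_pXn2r ?nnegrE.
have even n : ip (iter n.*2 A x) x = ip (iter n A x) (iter n A x).
  by rewrite gram addnn.
have odd n : ip (iter n.*2.+1 A x) x = ip (S (iter n A x)) (S (iter n A x)).
  by rewrite ST -[T _]/(A _) -iterS gram addnS addnn.
rewrite -(odd_double_half k); case: (ssrnat.odd k); rewrite ?add1n ?add0n.
  rewrite -doubleS even odd dnorm_ge0 /=; apply: sq; exact: Tle.
by rewrite even odd dnorm_ge0 /=; apply: sq.
Qed.

(** * Projections *)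

Section Projection.
Context {P : {linear H -> H}} (projP : projection ip P).

Lemma projection_idem x : P (P x) = P x.
Proof. by case: projP => _ _ /(congr1 (fun f => f x)). Qed.

Lemma projection_pythagoras x : `|x| ^+ 2 = `|P x| ^+ 2 + `|x - P x| ^+ 2.
Proof.
case: projP => _ Padj _.
have Px : ip (P x) x = ip (P x) (P x) by rewrite -Padj projection_idem.
rewrite normBsq -(Padj x x) Px ip_norm; ring.
Qed.

Lemma projection_contraction x : `|P x| <= `|x|.
Proof.
rewrite -(ler_pXn2r (n := 2)) ?nnegrE // (projection_pythagoras x).
by rewrite lerDl exprn_ge0.
Qed.

(** Pythagoras leaves no room for a nonzero [x - P x]. *)
Lemma projection_fixed_norm x : `|x| <= `|P x| -> P x = x.
Proof.
rewrite -(ler_pXn2r (n := 2)) ?nnegrE // (projection_pythagoras x).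
rewrite gerDl => h; apply/esym/eqP; rewrite -subr_eq0 -normr_eq0.
by rewrite -sqrf_eq0 eq_le h exprn_ge0.
Qed.

Lemma ker_projection x : ker P (x - P x).
Proof. by rewrite /ker /= linearB /= projection_idem subrr. Qed.

End Projection.

(** * Products of two projections *)

Section TwoProjections.
Context {P Q : {linear H -> H}}.
Context (projP : projection ip P) (projQ : projection ip Q).

Lemma projection_comp_fixed x : `|x| <= `|P (Q x)| -> P x = x /\ Q x = x.
Proof.
move=> xPQ.
have Qx : Q x = x.
  apply: (projection_fixed_norm projQ).
  by rewrite (le_trans xPQ) // projection_contraction.
by rewrite Qx in xPQ; split=> //; apply: (projection_fixed_norm projP).
Qed.

Lemma is_adjoint_projection_comp : is_adjoint ip (P \o Q) (Q \o P).
Proof.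
by case: projP projQ => _ Padj _ [_ Qadj _] x y /=; rewrite Padj Qadj.
Qed.

(** The condition on the first power of [P Q] alone already puts a vector in
    the common range of [P] and [Q], where all powers of [P Q] and of its
    adjoint act as the identity. *)
Lemma unitary_part_projection_comp :
  unitary_part ip (P \o Q) = [set x | P x = x /\ Q x = x].
Proof.
have adj := adjointE is_adjoint_projection_comp.
apply/seteqP; split=> [x /(_ 1)[/= PQx _]|x [Px Qx] m /=].
  by apply: projection_comp_fixed; rewrite PQx.
by rewrite adj !iter_fix //= ?Qx ?Px.
Qed.

(** Von Neumann's alternating projections. The limit [y] is fixed by
    [A = P Q Q P]; then [y] is in the range of [P], so that [P Q y = y],
    and both projections fix [y] because no norm is lost. *)
Lemma alternating_projections_cvg x :
  exists2 y, P y = y /\ Q y = y &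
    iter n ((P \o Q) \o (Q \o P)) x @[n --> \oo] --> y.
Proof.
set A := _ \o _; pose u n := iter n A x.
have uy : cvgn u.
  apply: iter_adjoint_comp_cvg is_adjoint_projection_comp _ _ => z /=;
    by rewrite (le_trans (projection_contraction _ _)) //
               projection_contraction.
exists (limn u) => //; set y := limn u.
have Acont : continuous A.
  case: projP projQ => Pc _ _ [Qc _ _] z.
  by apply: continuous_comp; apply: continuous_comp; (exact: Pc || exact: Qc).
have Ay : A y = y.
  apply: (cvg_unique _ (F := u n.+1 @[n --> \oo])) => //.
    exact: (cvg_comp u A uy (Acont y)).
  by rewrite /= (cvg_shiftS u).
have Py : P y = y by rewrite -Ay /A /= projection_idem.
apply: projection_comp_fixed.
by rewrite -{1}Ay /A /= Py (projection_idem projQ).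
Qed.

(** The limit [y] of the alternating projections of [x] differs from [x] by a
    vector of the closed span, which is orthogonal to the fixed points. So
    [y] is a fixed point orthogonal to all fixed points. *)
Lemma orthogonal_fixed_points_sub :
  orthogonal_complement ip [set x | P x = x /\ Q x = x]
    `<=` closed_span_join (ker P) (ker Q).
Proof.
move=> x xM; set M := [set x | _] in xM.
have kerM : closed_span_join (ker P) (ker Q) `<=` orthogonal_complement ip M.
  case: projP projQ => _ Padj _ [_ Qadj _].
  by apply: closed_span_join_orthogonal => z z0 a [Pa Qa];
    [rewrite -Pa -Padj z0 linear0l|rewrite -Qa -Qadj z0 linear0l].
have [y yM uy] := alternating_projections_cvg x.
have kerP z : linear_span (ker P `|` ker Q) (z - P z).
  by apply: sub_linear_span; left; exact: ker_projection.
have kerQ z : linear_span (ker P `|` ker Q) (z - Q z).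
  by apply: sub_linear_span; right; exact: ker_projection.
have in_span n :
    linear_span (ker P `|` ker Q) (x - iter n ((P \o Q) \o (Q \o P)) x).
  elim: n => [|n IH /=].
    by have := kerP 0; rewrite linear0 !subrr.
  set z := iter n _ x in IH *; rewrite (projection_idem projQ).
  (* Apply P, Q and P one after the other, each changing the current vector by
     an element of its kernel. *)
  rewrite (_ : x - _ = (x - z) + ((z - P z) + ((P z - Q (P z))
                       + (Q (P z) - P (Q (P z)))))).
    apply: linear_spanD IH _; apply: linear_spanD (kerP _) _.
    exact: linear_spanD (kerQ _) (kerP _).
  by rewrite !addrA !subrK.
have xy : closed_span_join (ker P) (ker Q) (x - y).
  apply: (closed_cvg _ (@closed_closure _ _) _ _ (cvgB (cvg_cst x) uy)).
  by apply: nearW => n; exact/subset_closure/in_span.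
suff y0 : y = 0 by move: xy; rewrite y0 subr0.
have : ip (x - (x - y)) y = 0.
  by rewrite linearBl /= (xM y yM) (kerM _ xy _ yM) subr0.
by rewrite subKr => /eqP; rewrite dnorm_eq0 => /eqP.
Qed.

End TwoProjections.

End InnerProduct.

Theorem theorem3p2 (R : realType) (H : completeNormedModType R[i])
    (ip : {dot H for Num.conj}) (ip_norm : induces_norm ip)
    (H_separable : separable H)
    (T : {linear H -> H}) (T_bounded : continuous T)
    (T_product : exists P Q : {linear H -> H},
       [/\ projection ip P, projection ip Q & (T : H -> H) = P \o Q]) :
  cnu_part ip T = closed_span_join (ker T) (ker (adjoint ip T)).
Proof.
have [P [Q [projP projQ ->]]] := T_product.
have adj := is_adjoint_projection_comp projP projQ.
rewrite /cnu_part (unitary_part_projection_comp ip_norm projP projQ).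
rewrite (adjointE adj).
apply/seteqP; split.
  move=> x /(orthogonal_fixed_points_sub ip_norm projP projQ).
  apply: closure_subset => _ [n [c [v [kv ->]]]].
  exists n, c, v; split=> // i; rewrite /ker /=.
  by case: (kv i) => /= ->; [right|left]; rewrite linear0.
case: projP projQ => _ Padj _ [_ Qadj _].
apply: closed_span_join_orthogonal => // x x0 a [Pa Qa].
  by rewrite -Qa -Pa -Qadj -Padj [P _]x0 linear0l.
by rewrite -Pa -Qa -Padj -Qadj [Q _]x0 linear0l.
Qed.
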